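(* Suppose $\sum_{n=1}^{\infty}a_{n}$ is a series of nonzero real numbers for which the limit \[ p=\lim_{n\to\infty}n\left(\left|\frac{a_{n}}{a_{n+1}}\right|-1\right) \] exists as a finite value. Then: (i) if $p>1$, the series $\sum_{n=1}^{\infty}a_{n}$ converges absolutely; (ii) if $p<0$, the series $\sum_{n=1}^{\infty}a_{n}$ diverges; (iii) if $0\leq p<1$, the series $\sum_{n=1}^{\infty}a_{n}$ is either conditionally convergent or divergent (that is, it does not converge absolutely). Moreover, (iv) if $p=1$, the test provides no information: among series $\sum_{n=1}^{\infty}a_{n}$ of nonzero real numbers for which the limit $\lim_{n\to\infty}n\left(\left|\frac{a_{n}}{a_{n+1}}\right|-1\right)$ exists and equals $1$, there is one that diverges, one that converges conditionally, and one that converges absolutely.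
   Context: A series is conditionally convergent if it converges but does not converge absolutely. *)

(* Defs.v *)
(* Stdlib reals with Coquelicot. *)
From Stdlib Require Import Reals.
From Coquelicot Require Import Coquelicot.

Open Scope R_scope.

(* A series sum_{n >= 1} a_n is given by a : nat -> R; the value a 0 plays no
   role, whence the shift with respect to Coquelicot's series, which start at
   index 0. *)

Definition nonzero_terms (a : nat -> R) : Prop :=
  forall n : nat, (1 <= n)%nat -> a n <> 0.

Definition converges (a : nat -> R) : Prop :=
  ex_series (fun n : nat => a (S n)).

Definition diverges (a : nat -> R) : Prop := ~ converges a.

Definition converges_absolutely (a : nat -> R) : Prop :=
  converges (fun n : nat => Rabs (a n)).

Definition converges_conditionally (a : nat -> R) : Prop :=
  converges a /\ ~ converges_absolutely a.

Definition raabe_limit (a : nat -> R) (p : R) : Prop :=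
  is_lim_seq (fun n : nat => INR n * (Rabs (a n / a (S n)) - 1)) (Finite p).

(* Main.v *)
Require Import Defs.
From Stdlib Require Import Reals Lra Lia Classical.
From Coquelicot Require Import Coquelicot.

Open Scope R_scope.

(** Write [c_n = n (|a_n / a_{n+1}| - 1)], so that
    [n |a_n| = (n + c_n) |a_{n+1}|].  The three cases of the test read off the
    behaviour of [|a_n|] or [n |a_n|] from this identity once [c_n] is
    separated from the relevant threshold
    ([raabe_ratio_lower], [raabe_ratio_upper]).

    If [p > 1], fix [1 < q < p].  Eventually [c_n > q], whence
    [(q - 1) |a_{n+1}| <= n |a_n| - (n + 1) |a_{n+1}|]: the terms are dominated
    by the increments of a nonnegative decreasing sequence, and such increments
    have a finite sum ([ex_series_le_telescoping]).  If [p < 1], eventually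
    [c_n < 1], so [n |a_n|] is eventually increasing, [|a_n|] is eventually at least a
    constant multiple of [1 / n], and absolute convergence fails by comparison
    with the harmonic series ([not_ex_series_ge_harmonic]).  If [p < 0],
    eventually [|a_n|] itself increases, so the terms do not tend to [0].

    For [p = 1] the witnesses are [1 / n], [(-1)^(n+1) / n] and
    [1 / (n ln^2 (n + 1))].  The last one converges because its terms are, up to
    a factor [2], dominated by the increments of [1 / ln (n + 1)], and its Raabe
    limit is [1] because [ln (n + 2) - ln (n + 1)] is at most [1 / (n + 1)],
    which is negligible against [ln (n + 1) / n]. *)

(** * Telescoping comparison *)

Lemma sum_n_telescoping (t : nat -> R) (n : nat) :
  sum_n (fun k => t k - t (S k)) n = t O - t (S n).
Proof.
  induction n as [|n IH].
  - now rewrite sum_O.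
  - rewrite sum_Sn, IH. unfold plus; simpl. ring.
Qed.

Lemma ex_series_telescoping (t : nat -> R) :
  ex_series (fun k => t k - t (S k)) <-> ex_finite_lim_seq t.
Proof.
  split; intros [l Hl].
  - exists (t O - l). apply is_lim_seq_incr_1.
    apply is_lim_seq_ext with
      (fun n => t O - sum_n (fun k => t k - t (S k)) n).
    + intro n. rewrite sum_n_telescoping. ring.
    + apply is_lim_seq_minus'; [apply is_lim_seq_const | exact Hl].
  - exists (t O - l).
    change (is_lim_seq (sum_n (fun k => t k - t (S k))) (t O - l)).
    apply is_lim_seq_ext with (fun n => t O - t (S n)).
    + intro n. now rewrite sum_n_telescoping.
    + apply is_lim_seq_minus'; [apply is_lim_seq_const|].
      now apply -> is_lim_seq_incr_1.
Qed.

(** Kummer's form of the comparison test: [t] decreases and is bounded below, so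
    it converges, and its increments form a convergent series. *)
Lemma ex_series_le_telescoping (b t : nat -> R) (c : R) (N : nat) :
  0 < c ->
  (forall n, (N <= n)%nat -> 0 <= b n) ->
  (forall n, (N <= n)%nat -> 0 <= t n) ->
  (forall n, (N <= n)%nat -> c * b n <= t n - t (S n)) ->
  ex_series b.
Proof.
  intros Hc Hb Ht Hbt.
  apply (ex_series_incr_n b N).
  set (u := fun k => t (N + k)%nat).
  assert (Hu : forall k, c * b (N + k)%nat <= u k - u (S k)).
  { intro k. unfold u. rewrite <- plus_n_Sm. apply Hbt. lia. }
  apply (@ex_series_le R_AbsRing R_CompleteNormedModule)
    with (fun k => (u k - u (S k)) * / c).
  - intro k. change (Rabs (b (N + k)%nat) <= (u k - u (S k)) * / c).
    rewrite Rabs_pos_eq by (apply Hb; lia).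
    apply Rmult_le_reg_l with c; [exact Hc|].
    replace (c * ((u k - u (S k)) * / c)) with (u k - u (S k)) by (field; lra).
    apply Hu.
  - apply ex_series_scal_r, ex_series_telescoping.
    apply ex_finite_lim_seq_decr with 0.
    + intro k. specialize (Hu k).
      assert (0 <= c * b (N + k)%nat)
        by (apply Rmult_le_pos; [lra | apply Hb; lia]).
      lra.
    + intro k. apply Ht. lia.
Qed.

(** * Logarithms of consecutive integers *)

Lemma ln_le_pred (x : R) : 0 < x -> ln x <= x - 1.
Proof.
  intro Hx. pose proof (exp_ineq1_le (ln x)) as H.
  rewrite exp_ln in H by exact Hx. lra.
Qed.

Lemma ln_succ_upper (x : R) : 0 < x -> ln (x + 1) - ln x <= / x.
Proof.
  intro Hx. rewrite <- ln_div by lra.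
  replace (/ x) with ((x + 1) / x - 1) by (field; lra).
  apply ln_le_pred, Rdiv_lt_0_compat; lra.
Qed.

Lemma ln_succ_lower (x : R) : 0 < x -> / (x + 1) <= ln (x + 1) - ln x.
Proof.
  intro Hx.
  assert (H : ln x - ln (x + 1) <= x / (x + 1) - 1).
  { rewrite <- ln_div by lra. apply ln_le_pred, Rdiv_lt_0_compat; lra. }
  replace (x / (x + 1) - 1) with (- / (x + 1)) in H by (field; lra).
  lra.
Qed.

Lemma ln_INR_succ_pos (n : nat) : (1 <= n)%nat -> 0 < ln (INR n + 1).
Proof.
  intro Hn. apply le_INR in Hn. simpl in Hn.
  rewrite <- ln_1. apply ln_increasing; lra.
Qed.

Lemma is_lim_seq_ln_INR_succ : is_lim_seq (fun n => ln (INR n + 1)) p_infty.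
Proof.
  apply is_lim_seq_ext with (fun n => ln (INR (S n))).
  { intro n. now rewrite S_INR. }
  apply (is_lim_seq_incr_1 (fun n => ln (INR n))).
  apply is_lim_comp_seq with p_infty.
  - apply is_lim_ln_p.
  - now exists O.
  - apply is_lim_seq_INR.
Qed.

Lemma is_lim_seq_inv_ln_INR_succ :
  is_lim_seq (fun n => / ln (INR n + 1)) 0.
Proof.
  apply (is_lim_seq_inv _ p_infty); [apply is_lim_seq_ln_INR_succ | discriminate].
Qed.

(** * Comparison with the harmonic series *)

(** The harmonic terms dominate the increments of [ln (n + 1)], which is
    unbounded. *)
Lemma not_ex_series_harmonic : ~ ex_series (fun n => / (INR n + 1)).
Proof.
  intro H.
  assert (Hl : ex_finite_lim_seq (fun n => - ln (INR n + 1))).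
  { apply ex_series_telescoping.
    apply (@ex_series_le R_AbsRing R_CompleteNormedModule)
      with (fun n => / (INR n + 1)); [|exact H].
    intro n. pose proof (pos_INR n) as Hn.
    change (Rabs (- ln (INR n + 1) - - ln (INR (S n) + 1)) <= / (INR n + 1)).
    rewrite S_INR.
    pose proof (ln_succ_upper (INR n + 1) ltac:(lra)) as Hup.
    pose proof (ln_succ_lower (INR n + 1) ltac:(lra)) as Hlo.
    assert (0 < / (INR n + 1 + 1)) by (apply Rinv_0_lt_compat; lra).
    rewrite Rabs_pos_eq; lra. }
  destruct Hl as [l Hl].
  assert (Hm : is_lim_seq (fun n => - ln (INR n + 1)) m_infty).
  { apply -> (is_lim_seq_opp (fun n => ln (INR n + 1)) p_infty).
    apply is_lim_seq_ln_INR_succ. }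
  apply is_lim_seq_unique in Hl. apply is_lim_seq_unique in Hm.
  rewrite Hm in Hl. discriminate.
Qed.

Lemma not_ex_series_ge_harmonic (b : nat -> R) (c : R) (N : nat) :
  0 < c -> (forall n, (N <= n)%nat -> c / (INR n + 1) <= b n) ->
  ~ ex_series b.
Proof.
  intros Hc Hb Hex. apply not_ex_series_harmonic.
  apply (ex_series_incr_n _ N).
  apply (@ex_series_le R_AbsRing R_CompleteNormedModule)
    with (fun k => b (N + k)%nat * / c).
  - intro k. pose proof (pos_INR (N + k)) as Hn.
    change (Rabs (/ (INR (N + k) + 1)) <= b (N + k)%nat * / c).
    rewrite Rabs_pos_eq by (apply Rlt_le, Rinv_0_lt_compat; lra).
    apply Rmult_le_reg_r with c; [exact Hc|].
    rewrite Rmult_assoc, Rinv_l, Rmult_1_r by lra.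
    rewrite Rmult_comm. apply Hb. lia.
  - apply ex_series_scal_r. now apply -> (ex_series_incr_n b N).
Qed.

(** * The test away from the critical value *)

Lemma raabe_ratio (a : nat -> R) (n : nat) :
  a (S n) <> 0 ->
  INR n * Rabs (a n) =
  (INR n + INR n * (Rabs (a n / a (S n)) - 1)) * Rabs (a (S n)).
Proof.
  intro H. rewrite Rabs_div by exact H. field. now apply Rabs_no_R0.
Qed.

Lemma raabe_ratio_lower (a : nat -> R) (p q : R) :
  nonzero_terms a -> raabe_limit a p -> q < p ->
  exists N, (1 <= N)%nat /\ forall n, (N <= n)%nat ->
    (INR n + q) * Rabs (a (S n)) < INR n * Rabs (a n).
Proof.
  intros Ha Hp Hq.
  destruct (Hp (fun x => q < x) (open_gt q p Hq)) as [N HN].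
  exists (S N). split; [lia|]. intros n Hn.
  rewrite (raabe_ratio a n) by (apply Ha; lia).
  apply Rmult_lt_compat_r; [apply Rabs_pos_lt, Ha; lia|].
  specialize (HN n ltac:(lia)). simpl in HN. lra.
Qed.

Lemma raabe_ratio_upper (a : nat -> R) (p q : R) :
  nonzero_terms a -> raabe_limit a p -> p < q ->
  exists N, (1 <= N)%nat /\ forall n, (N <= n)%nat ->
    INR n * Rabs (a n) < (INR n + q) * Rabs (a (S n)).
Proof.
  intros Ha Hp Hq.
  destruct (Hp (fun x => x < q) (open_lt q p Hq)) as [N HN].
  exists (S N). split; [lia|]. intros n Hn.
  rewrite (raabe_ratio a n) by (apply Ha; lia).
  apply Rmult_lt_compat_r; [apply Rabs_pos_lt, Ha; lia|].
  specialize (HN n ltac:(lia)). simpl in HN. lra.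
Qed.

Lemma eventually_increasing_ge (u : nat -> R) (N n : nat) :
  (forall k, (N <= k)%nat -> u k <= u (S k)) -> (N <= n)%nat -> u N <= u n.
Proof.
  intros Hu Hn. induction Hn as [|n Hn IH]; [lra|].
  specialize (Hu n Hn). lra.
Qed.

(** With [1 < q < p], [n |a_n|] decreases by at least [(q - 1) |a_{n+1}|] at
    each step. *)
Lemma raabe_converges_absolutely (a : nat -> R) (p : R) :
  nonzero_terms a -> raabe_limit a p -> 1 < p -> converges_absolutely a.
Proof.
  intros Ha Hp H.
  destruct (raabe_ratio_lower a p ((1 + p) / 2) Ha Hp) as [N [_ HN]]; [lra|].
  apply ex_series_le_telescoping
    with (t := fun n => INR n * Rabs (a n)) (c := (p - 1) / 2) (N := N).
  - lra.
  - intros n _. apply Rabs_pos.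
  - intros n _. apply Rmult_le_pos; [apply pos_INR | apply Rabs_pos].
  - intros n Hn. specialize (HN n Hn). rewrite S_INR. lra.
Qed.

(** [n |a_n|] eventually increases, so [|a_n|] stays above a multiple of
    [1 / n]. *)
Lemma raabe_not_converges_absolutely (a : nat -> R) (p : R) :
  nonzero_terms a -> raabe_limit a p -> p < 1 -> ~ converges_absolutely a.
Proof.
  intros Ha Hp H.
  destruct (raabe_ratio_upper a p 1 Ha Hp H) as [N [HN1 HN]].
  apply not_ex_series_ge_harmonic
    with (c := INR N * Rabs (a N)) (N := N).
  - apply Rmult_lt_0_compat; [apply lt_0_INR; lia | apply Rabs_pos_lt, Ha, HN1].
  - intros n Hn. pose proof (pos_INR n).
    apply Rmult_le_reg_r with (INR n + 1); [lra|].
    unfold Rdiv. rewrite Rmult_assoc, Rinv_l, Rmult_1_r by lra.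
    rewrite <- S_INR, (Rmult_comm (Rabs (a (S n)))).
    apply (eventually_increasing_ge (fun k => INR k * Rabs (a k))); [|lia].
    intros k Hk. rewrite S_INR. specialize (HN k Hk). lra.
Qed.

(** [|a_n|] eventually increases, so the terms stay away from [0]. *)
Lemma raabe_diverges (a : nat -> R) (p : R) :
  nonzero_terms a -> raabe_limit a p -> p < 0 -> diverges a.
Proof.
  intros Ha Hp H Hconv.
  destruct (raabe_ratio_upper a p 0 Ha Hp H) as [N [HN1 HN]].
  pose proof (Rabs_pos_lt _ (Ha N HN1)) as Hpos.
  apply ex_series_lim_0, is_lim_seq_abs_0 in Hconv.
  assert (Hle : Rbar_le (Rabs (a N)) 0).
  { apply is_lim_seq_le_loc
      with (fun _ : nat => Rabs (a N)) (fun n => Rabs (a (S n))).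
    - exists N. intros n Hn.
      apply (eventually_increasing_ge (fun k => Rabs (a k))); [|lia].
      intros k Hk. apply Rmult_le_reg_l with (INR k); [apply lt_0_INR; lia|].
      specialize (HN k Hk). lra.
    - apply is_lim_seq_const.
    - exact Hconv. }
  simpl in Hle. lra.
Qed.

(** * The critical value *)

Lemma raabe_limit_of_abs_inv (a : nat -> R) :
  (forall n, Rabs (a n) = / INR n) -> raabe_limit a 1.
Proof.
  intro Ha. unfold raabe_limit.
  apply is_lim_seq_ext_loc with (fun _ : nat => 1); [|apply is_lim_seq_const].
  exists 1%nat. intros n Hn. apply lt_0_INR in Hn.
  assert (Hnz : a (S n) <> 0).
  { intro E. specialize (Ha (S n)). rewrite E, Rabs_R0, S_INR in Ha.
    pose proof (Rinv_0_lt_compat (INR n + 1) ltac:(lra)). lra. }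
  rewrite Rabs_div, !Ha, S_INR by exact Hnz. field. lra.
Qed.

Lemma nonzero_terms_of_abs_inv (a : nat -> R) :
  (forall n, Rabs (a n) = / INR n) -> nonzero_terms a.
Proof.
  intros Ha n Hn E. apply lt_0_INR, Rinv_0_lt_compat in Hn.
  specialize (Ha n). rewrite E, Rabs_R0 in Ha. lra.
Qed.

Lemma diverges_inv : diverges (fun n => / INR n).
Proof.
  intro H. apply not_ex_series_harmonic. revert H. apply ex_series_ext.
  intro n. now rewrite S_INR.
Qed.

Lemma Rabs_inv_INR (n : nat) : Rabs (/ INR n) = / INR n.
Proof. now rewrite Rabs_inv, (Rabs_pos_eq (INR n)) by apply pos_INR. Qed.

Lemma Rabs_alternating_inv (n : nat) : Rabs ((-1) ^ S n / INR n) = / INR n.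
Proof.
  unfold Rdiv. now rewrite Rabs_mult, pow_1_abs, Rmult_1_l, Rabs_inv_INR.
Qed.

Lemma converges_alternating_inv : converges (fun n => (-1) ^ S n / INR n).
Proof.
  apply ex_series_ext with (tg_alt (fun n => / INR (S n))).
  { intro n.
    change ((-1) ^ n * / INR (S n) = (-1 * (-1 * (-1) ^ n)) * / INR (S n)).
    ring. }
  apply ex_series_Reals_1, alternated_series.
  - intro n. apply Rinv_le_contravar; [apply lt_0_INR; lia | apply le_INR; lia].
  - apply is_lim_seq_Reals, (is_lim_seq_incr_1 (fun n => / INR n)).
    apply (is_lim_seq_inv _ p_infty); [apply is_lim_seq_INR | discriminate].
Qed.

Lemma converges_conditionally_alternating_inv :
  converges_conditionally (fun n => (-1) ^ S n / INR n).
Proof.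
  split; [apply converges_alternating_inv|].
  intro H. apply diverges_inv. revert H. apply ex_series_ext.
  intro n. apply Rabs_alternating_inv.
Qed.

Definition inv_ln_sqr (n : nat) : R := / (INR n * ln (INR n + 1) ^ 2).

Lemma inv_ln_sqr_pos (n : nat) : (1 <= n)%nat -> 0 < inv_ln_sqr n.
Proof.
  intro Hn. apply Rinv_0_lt_compat, Rmult_lt_0_compat.
  - now apply lt_0_INR.
  - now apply pow_lt, ln_INR_succ_pos.
Qed.

(** With [l = ln (n + 1)] and [l' = ln (n + 2)],
    [1 / l - 1 / l' = (l' - l) / (l l') >= 1 / ((n + 2) l' ^ 2)], and
    [n + 2 <= 2 (n + 1)]. *)
Lemma converges_absolutely_inv_ln_sqr : converges_absolutely inv_ln_sqr.
Proof.
  apply ex_series_le_telescoping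
    with (t := fun n => / ln (INR n + 1)) (c := / 2) (N := 1%nat).
  - lra.
  - intros n _. apply Rabs_pos.
  - intros n Hn. now apply Rlt_le, Rinv_0_lt_compat, ln_INR_succ_pos.
  - intros n Hn.
    rewrite Rabs_pos_eq by (apply Rlt_le, inv_ln_sqr_pos; lia).
    unfold inv_ln_sqr.
    pose proof (ln_INR_succ_pos n Hn) as Hl.
    pose proof (ln_INR_succ_pos (S n) ltac:(lia)) as Hl'.
    rewrite S_INR in *. apply lt_0_INR in Hn.
    pose proof (ln_succ_lower (INR n + 1) ltac:(lra)) as Hd.
    set (x := INR n) in *. set (l := ln (x + 1)) in *.
    set (l' := ln (x + 1 + 1)) in *.
    assert (Hx : 0 < / (x + 1 + 1)) by (apply Rinv_0_lt_compat; lra).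
    apply Rle_trans with (/ (x + 1 + 1) * / l' * / l').
    + replace (/ 2 * / ((x + 1) * l' ^ 2)) with (/ (2 * (x + 1)) * / l' * / l')
        by (field; lra).
      pose proof (Rinv_0_lt_compat _ Hl').
      repeat apply Rmult_le_compat_r; try lra.
      apply Rinv_le_contravar; lra.
    + replace (/ l - / l') with ((l' - l) * / l * / l') by (field; lra).
      apply Rmult_le_compat_r; [now apply Rlt_le, Rinv_0_lt_compat|].
      apply Rmult_le_compat; try lra.
      * now apply Rlt_le, Rinv_0_lt_compat.
      * apply Rinv_le_contravar; lra.
Qed.

(** With [r = ln (n + 2) / ln (n + 1)], the Raabe expression is
    [1 + (n + 1) (r - 1) (r + 1)], where
    [0 <= (n + 1) (r - 1) <= 1 / ln (n + 1)] and [r + 1] is bounded. *)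
Lemma raabe_limit_inv_ln_sqr : raabe_limit inv_ln_sqr 1.
Proof.
  unfold raabe_limit.
  apply is_lim_seq_le_le_loc with
    (fun _ : nat => 1)
    (fun n => 1 + / ln (INR n + 1) * (2 + / ln (INR n + 1))).
  - exists 1%nat. intros n Hn.
    rewrite Rabs_pos_eq
      by (apply Rlt_le, Rdiv_lt_0_compat; apply inv_ln_sqr_pos; lia).
    unfold inv_ln_sqr.
    pose proof (ln_INR_succ_pos n Hn) as Hl.
    pose proof (ln_INR_succ_pos (S n) ltac:(lia)) as Hl'.
    rewrite S_INR in *. apply le_INR in Hn. simpl in Hn.
    pose proof (ln_succ_lower (INR n + 1) ltac:(lra)) as Hlo.
    pose proof (ln_succ_upper (INR n + 1) ltac:(lra)) as Hup.
    set (x := INR n) in *. set (l := ln (x + 1)) in *.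
    set (l' := ln (x + 1 + 1)) in *.
    assert (Hx : 0 < / (x + 1 + 1)) by (apply Rinv_0_lt_compat; lra).
    pose proof (Rinv_0_lt_compat _ Hl) as Hil.
    set (d := (x + 1) * (l' - l)).
    assert (Hd : 0 <= d <= 1).
    { unfold d. split; [apply Rmult_le_pos; lra|].
      apply Rle_trans with ((x + 1) * / (x + 1)); [|right; field; lra].
      apply Rmult_le_compat_l; lra. }
    assert (Hll : 0 <= l' - l <= 1).
    { split; [lra|]. apply Rle_trans with (/ (x + 1)); [exact Hup|].
      apply Rle_trans with (/ 1); [apply Rinv_le_contravar|]; lra. }
    replace (x * (/ (x * l ^ 2) / / ((x + 1) * l' ^ 2) - 1))
      with (1 + (d * / l) * (2 + (l' - l) * / l))
      by (unfold d; field; lra).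
    assert (0 <= d * / l <= / l).
    { split; [apply Rmult_le_pos; lra|].
      rewrite <- (Rmult_1_l (/ l)) at 2. apply Rmult_le_compat_r; lra. }
    assert (0 <= (l' - l) * / l <= / l).
    { split; [apply Rmult_le_pos; lra|].
      rewrite <- (Rmult_1_l (/ l)) at 2. apply Rmult_le_compat_r; lra. }
    split.
    + assert (0 <= d * / l * (2 + (l' - l) * / l)) by (apply Rmult_le_pos; lra).
      lra.
    + apply Rplus_le_compat_l, Rmult_le_compat; lra.
  - apply is_lim_seq_const.
  - replace (Finite 1) with (Finite (1 + 0 * (2 + 0))) by (f_equal; ring).
    pose proof is_lim_seq_inv_ln_INR_succ as H.
    apply is_lim_seq_plus'; [apply is_lim_seq_const|].
    apply is_lim_seq_mult'; [exact H|].
    apply is_lim_seq_plus'; [apply is_lim_seq_const | exact H].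
Qed.

(** * Raabe's test *)

Theorem theorem1 :
  (forall (a : nat -> R) (p : R),
     nonzero_terms a -> raabe_limit a p ->
     (p > 1 -> converges_absolutely a) /\
     (p < 0 -> diverges a) /\
     (0 <= p < 1 ->
        (converges_conditionally a \/ diverges a) /\
        ~ converges_absolutely a)) /\
  (exists a : nat -> R,
     nonzero_terms a /\ raabe_limit a 1 /\ diverges a) /\
  (exists a : nat -> R,
     nonzero_terms a /\ raabe_limit a 1 /\ converges_conditionally a) /\
  (exists a : nat -> R,
     nonzero_terms a /\ raabe_limit a 1 /\ converges_absolutely a).
Proof.
  split; [|split; [|split]].
  - intros a p Ha Hp. split; [|split].
    + now apply raabe_converges_absolutely.
    + now apply raabe_diverges.
    + intros [_ H].
      pose proof (raabe_not_converges_absolutely a p Ha Hp H) as Hn.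
      split; [|exact Hn].
      destruct (classic (converges a)) as [Hc|Hc]; [left | right; exact Hc].
      now split.
  - exists (fun n => / INR n). split; [|split].
    + apply nonzero_terms_of_abs_inv, Rabs_inv_INR.
    + apply raabe_limit_of_abs_inv, Rabs_inv_INR.
    + apply diverges_inv.
  - exists (fun n => (-1) ^ S n / INR n). split; [|split].
    + apply nonzero_terms_of_abs_inv, Rabs_alternating_inv.
    + apply raabe_limit_of_abs_inv, Rabs_alternating_inv.
    + apply converges_conditionally_alternating_inv.
  - exists inv_ln_sqr. split; [|split].
    + intros n Hn. now apply Rgt_not_eq, inv_ln_sqr_pos.
    + apply raabe_limit_inv_ln_sqr.
    + apply converges_absolutely_inv_ln_sqr.
Qed.
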